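(* Let $\mathfrak{A}$ be a unital $C^*$-algebra and $a\in\mathfrak{A}$. Then $$\partial_{+}DW_{\mathfrak{A}}(a^* )=\{(\overline{\mu},h_a^{\mathfrak{A}}(\mu)):(\mu,h_a^{\mathfrak{A}}(\mu))\in\partial_{+}DW_{\mathfrak{A}}(a)\}.$$
   Context: $\mathfrak{A}$ is a complex, nonzero, unital $C^*$-algebra with unit $\boldsymbol{1}$; its state space $\mathfrak{S}(\mathfrak{A})$ is the set of all positive linear functionals $f\in\mathfrak{A}^*$ with $\|f\|=f(\boldsymbol{1})=1$. For any $b\in\mathfrak{A}$ (in particular $b=a$ or $b=a^*$): $W_{\mathfrak{A}}(b)=\{f(b):f\in\mathfrak{S}(\mathfrak{A})\}$; $DW_{\mathfrak{A}}(b)=\{(f(b),f(b^*b)):f\in\mathfrak{S}(\mathfrak{A})\}\subset\mathbb{C}\times\mathbb{R}$; for $\mu\in W_{\mathfrak{A}}(b)$, $\mathscr{L}_{\mu}^{\mathfrak{A}}(b)=\{r:(\mu,r)\in DW_{\mathfrak{A}}(b)\}$; the height function is $h_b^{\mathfrak{A}}:W_{\mathfrak{A}}(b)\to\mathbb{R}$, $h_b^{\mathfrak{A}}(\mu)=\sup\mathscr{L}_{\mu}^{\mathfrak{A}}(b)$; and the upper boundary of $DW_{\mathfrak{A}}(b)$ is the graph of the height function, $\partial_{+}DW_{\mathfrak{A}}(b)=\{(\mu,h_b^{\mathfrak{A}}(\mu)):\mu\in W_{\mathfrak{A}}(b)\}$. *)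

(* Defs.v *)
From HB Require Import structures.
From mathcomp Require Import all_boot all_order all_algebra.
From mathcomp Require Import complex.
From mathcomp Require Import all_classical all_reals all_analysis.

Set Implicit Arguments.
Unset Strict Implicit.
Unset Printing Implicit Defensive.

Import Order.TTheory GRing.Theory Num.Theory.
Import numFieldNormedType.Exports.
Import ComplexField.Normc.

Local Open Scope classical_set_scope.
Local Open Scope ring_scope.
Local Open Scope complex_scope.

(* One type cannot carry both a ring structure and [NormedModule] (the two
   hierarchies lack a join), so the norm is introduced as a real-valued
   function on the algebra [A], and the corresponding normed space is the
   alias [normed_of A] below. *)
HB.mixin Record Algebra_isStarNormed (R : realType) A
    of GRing.Algebra R[i] A := {
  cnorm : A -> R ;
  cnormD : forall x y : A, cnorm (x + y) <= cnorm x + cnorm y ;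
  cnormZ : forall (c : R[i]) (x : A), cnorm (c *: x) = normc c * cnorm x ;
  cnorm0_eq0 : forall x : A, cnorm x = 0 -> x = 0 ;
  cnormM : forall x y : A, cnorm (x * y) <= cnorm x * cnorm y ;
  star : A -> A ;
  starK : forall x : A, star (star x) = x ;
  starD : forall x y : A, star (x + y) = star x + star y ;
  starZ : forall (c : R[i]) (x : A), star (c *: x) = conjc c *: star x ;
  starM : forall x y : A, star (x * y) = star y * star x ;
  cnorm_starM : forall x : A, cnorm (star x * x) = cnorm x ^+ 2
}.

#[short(type="preCstarAlgType")]
HB.structure Definition PreCstarAlgebra (R : realType) :=
  {A of Algebra_isStarNormed R A & GRing.Algebra R[i] A}.

Definition normed_of (R : realType) (A : preCstarAlgType R) : Type := A.

Section NormedOf.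
Variables (R : realType) (A : preCstarAlgType R).

HB.instance Definition _ := GRing.Lmodule.copy (normed_of A) A.

Let norm_of (x : normed_of A) : R[i] := (cnorm (x : A))%:C.

Let norm_ofD x y : norm_of (x + y) <= norm_of x + norm_of y.
Proof. by rewrite /norm_of -rmorphD lecR; exact: cnormD. Qed.

Let norm_ofZ (c : R[i]) x : norm_of (c *: x) = `|c| * norm_of x.
Proof.
by rewrite /norm_of (cnormZ c (x : A)) rmorphM.
Qed.

Let norm_of0_eq0 x : norm_of x = 0 -> x = 0.
Proof. by move=> [/(@cnorm0_eq0 R A)]. Qed.

HB.instance Definition _ :=
  Lmodule_isNormed.Build R[i] (normed_of A) norm_ofD norm_ofZ norm_of0_eq0.

End NormedOf.

HB.mixin Record PreCstar_isComplete (R : realType) A of PreCstarAlgebra R A := {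
  normed_cauchy_cvg : forall F : set_system (normed_of A),
    ProperFilter F -> cauchy F -> cvg F
}.

#[short(type="cstarAlgType")]
HB.structure Definition CstarAlgebra (R : realType) :=
  {A of PreCstarAlgebra R A & PreCstar_isComplete R A}.

HB.instance Definition _ (R : realType) (A : cstarAlgType R) :=
  Uniform_isComplete.Build (normed_of A) (@normed_cauchy_cvg R A).

Section DavisWielandt.
Variables (R : realType) (A : cstarAlgType R).

Definition dual_norm (f : {scalar A}) : R :=
  sup [set normc (f x) | x in [set x : A | cnorm x <= 1]].

(* The order of [R[i]] satisfies [0 <= z] iff [z] is a nonnegative real. *)
Definition positive_functional (f : {scalar A}) : Prop :=
  forall x : A, 0 <= f (star x * x).

Definition state_space : set {scalar A} :=
  [set f : {scalar A} | [/\ continuous (f : normed_of A -> R[i]^o),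
     positive_functional f, dual_norm f = 1 & f 1 = 1]].

Definition num_range (b : A) : set R[i] := [set f b | f in state_space].

(* As [f] is positive, [f (star b * b)] is real: [Re] only changes its type. *)
Definition DW (b : A) : set (R[i] * R) :=
  [set (f b, complex.Re (f (star b * b))) | f in state_space].

Definition fiber (b : A) (mu : R[i]) : set R := [set r | DW b (mu, r)].

(* Meaningful for [mu] in [num_range b]. *)
Definition height (b : A) (mu : R[i]) : R := sup (fiber b mu).

Definition upper_boundary (b : A) : set (R[i] * R) :=
  [set (mu, height b mu) | mu in num_range b].

End DavisWielandt.

(* Main.v *)
(* For a state f and b := a - f(a), so that f(b) = 0, we produce a state g with
   g(b) = 0 and g(b b^* ) >= r := f(b^* b); the two heights then dominate each
   other. If |f(b b)| >= r, Cauchy-Schwarz allows g := f. Otherwise let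
   g := f(w^* _ w) / f(w^* w) with w := t + b, where the scalar t solves
   g(b) = 0, i.e. t r + conj(t) f(b b) + f(b^* b b) = 0. In the GNS space,
   Bessel's inequality for b^* w against 1 and b yields g(b b^* ) >= r. This is
   the fact that a 2x2 matrix is unitarily equivalent to its transpose. *)

From HB Require Import structures.
Require Import Defs.
From mathcomp Require Import all_boot all_order all_algebra.
From mathcomp Require Import complex.
From mathcomp Require Import all_classical all_reals all_analysis.
From mathcomp Require Import ring lra.
Import Order.TTheory GRing.Theory Num.Theory.
Import numFieldNormedType.Exports.
Import ComplexField.Normc.
Local Open Scope classical_set_scope.
Local Open Scope ring_scope.
Local Open Scope complex_scope.

(** * Conjugation, the unit and the norm *)

Lemma conjcN {R : realType} (z : R[i]) : conjc (- z) = - conjc z.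
Proof. by case: z. Qed.

Lemma conjcD {R : realType} (z w : R[i]) : conjc (z + w) = conjc z + conjc w.
Proof. exact: (rmorphD (conjc : {rmorphism R[i] -> R[i]})). Qed.

Lemma conjcM {R : realType} (z w : R[i]) : conjc (z * w) = conjc z * conjc w.
Proof. exact: (rmorphM (conjc : {rmorphism R[i] -> R[i]})). Qed.

Lemma star1 {R : realType} (A : preCstarAlgType R) : star (1 : A) = 1.
Proof. by rewrite -[RHS]starK -[in RHS](mulr1 (star 1)) starM starK mulr1. Qed.

Lemma cnorm0 {R : realType} (A : preCstarAlgType R) : cnorm (0 : A) = 0.
Proof. by rewrite -(scale0r (0 : A)) cnormZ normc0 mul0r. Qed.

Lemma cnorm_ge0 {R : realType} {A : preCstarAlgType R} (x : A) : 0 <= cnorm x.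
Proof.
have := cnormD x (- x); rewrite subrr cnorm0 -scaleN1r cnormZ.
by rewrite normcN normc1 mul1r -mulr2n pmulrn_lge0.
Qed.

Lemma cnorm1_le1 {R : realType} (A : preCstarAlgType R) : cnorm (1 : A) <= 1.
Proof.
have := cnorm_starM (1 : A); rewrite star1 mulr1 expr2.
have := cnorm_ge0 (1 : A); set n := cnorm _; nra.
Qed.

Lemma normcE_norm {R : realType} (z : R[i]) : (normc z)%:C = `|z|.
Proof. by []. Qed.

Lemma normc_ge0 {R : realType} (z : R[i]) : 0 <= normc z.
Proof. by case: z => x y; exact: sqrtr_ge0. Qed.

(** * Positive functionals: Cauchy-Schwarz and norm one *)

Section PositiveFunctional.
Context {R : realType} {A : cstarAlgType R} (f : {scalar A}).
Hypothesis f_pos : positive_functional f.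

(** Positivity at [x + c *: y], expanded; suitable values of [c] give hermitian symmetry and
    Cauchy-Schwarz. *)
Lemma positive_functional_sesqui (x y : A) (c : R[i]) :
  0 <= f (star x * x) + c * f (star x * y) + c^*%C * f (star y * x)
       + c^*%C * c * f (star y * y).
Proof.
have := f_pos (x + c *: y).
rewrite starD starZ !(mulrDl, mulrDr) -!(@scalerAl _ A, @scalerAr _ A) !linearD !linearZ /=.
by rewrite !addrA; congr (0 <= _); ring.
Qed.

Lemma positive_functional_Re (x : A) :
  f (star x * x) = (complex.Re (f (star x * x)))%:C.
Proof. by rewrite RRe_real // ger0_real. Qed.

Lemma positive_functional_herm (x y : A) :
  f (star y * x) = (f (star x * y))^*%C.
Proof.
(* The form is real: [c = 1] makes the imaginary parts opposite, [c = 'i] makes the real parts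
   equal. *)
have := positive_functional_sesqui x y 1.
have := positive_functional_sesqui x y ('i).
rewrite (positive_functional_Re x) (positive_functional_Re y).
case: (f (star y * x)) (f (star x * y)) => [a b] [c d].
rewrite !lecE /=; simpc => /= /andP[/eqP h1 _] /andP[/eqP h2 _].
by congr Complex; lra.
Qed.

Lemma positive_functional_star (x : A) : f (star x) = (f x)^*%C.
Proof.
by rewrite -[in RHS](mul1r x) -star1 positive_functional_herm conjcK mulr1.
Qed.

Lemma positive_functional_CS (x y : A) : 0 < f (star y * y) ->
  `|f (star y * x)| ^+ 2 <= f (star x * x) * f (star y * y).
Proof.
move=> Y0; have Yn0 := lt0r_neq0 Y0.
have YJ : (f (star y * y))^*%C = f (star y * y).
  by rewrite positive_functional_Re conjc_real.
(* This [c] makes [x + c *: y] orthogonal to [y], which minimises the form. *)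
have := positive_functional_sesqui x y (- (f (star y * x) / f (star y * y))).
rewrite (positive_functional_herm y x) sqr_normc.
rewrite conjcN conjcM conjc_inv YJ -(pmulr_lge0 _ Y0) -[in X in _ -> X]subr_ge0.
by congr (0 <= _); field.
Qed.

Hypothesis f1 : f 1 = 1.

Lemma normc_positive_functional_sqr (x : A) :
  normc (f x) ^+ 2 <= normc (f (star x * x)).
Proof.
have := positive_functional_CS x 1; rewrite star1 !mul1r f1 mulr1 ltr01.
move=> /(_ isT) le; rewrite -lecR rmorphXn /= !normcE_norm.
by rewrite (ger0_norm (f_pos x)).
Qed.

(* Iterating [|f x|^2 <= |f (x* x)|] and [|x* x| = |x|^2] turns a bound with
   constant [K] into one with constant [K^(2^-n)], for every [n]. *)
Lemma positive_functional_le_norm (K : R) :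
  (forall x : A, normc (f x) <= K * cnorm x) ->
  forall x : A, normc (f x) <= cnorm x.
Proof.
move=> fK x.
have iter n y : normc (f y) ^+ (2 ^ n) <= K * cnorm y ^+ (2 ^ n).
  elim: n y => [|n IHn] y; first exact: fK.
  rewrite expnS !exprM -cnorm_starM; apply: le_trans (IHn _).
  by rewrite lerXn2r ?nnegrE ?exprn_ge0 ?normc_ge0 ?normc_positive_functional_sqr.
have [->|xn0] := eqVneq x 0; first by rewrite raddf0 normc0 cnorm_ge0.
have x_gt0 : 0 < cnorm x.
  by rewrite lt0r cnorm_ge0 andbT; apply: contraNneq xn0 => /cnorm0_eq0 ->.
rewrite leNgt; apply/negP => lt_x.
(* If |f x| = (1 + d)|x| with d > 0, then (1 + d)^(2^n) <= K for all n; Bernoulli and n <= 2^n give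
   1 + n d <= K, against the Archimedean property. *)
have bern (d : R) (m : nat) : 0 <= d -> 1 + m%:R * d <= (1 + d) ^+ m.
  move=> d0; elim: m => [|m IHm]; first by rewrite mul0r addr0.
  rewrite exprSr; have := ler0n R m.
  move: IHm; rewrite -natr1; set u := (1 + d) ^+ m; set v := m%:R.
  by move=> *; nra.
set d := normc (f x) / cnorm x - 1.
have d0 : 0 < d by rewrite subr_gt0 ltr_pdivlMr ?mul1r.
have leK n : 1 + n%:R * d <= K.
  have := iter n x; rewrite -ler_pdivrMr ?exprn_gt0 // -expr_div_n.
  apply: le_trans; have := bern d (2 ^ n)%N (ltW d0).
  rewrite [X in X ^+ _]addrC subrK; apply: le_trans.
  by rewrite lerD2l ler_pM2r // ler_nat ltnW // ltn_expl.
have := leK (Num.bound (K / d)).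
have K0 : 0 <= K by apply: le_trans (leK 0%N); rewrite mul0r addr0.
have := archi_boundP (divr_ge0 K0 (ltW d0)); rewrite ltr_pdivrMr //.
by move: (_ * d) => u; lra.
Qed.

(** Any bound [K] improves to 1; this gives continuity, and the supremum in [dual_norm] is attained
    at the unit. *)
Lemma positive_functional_state (K : R) :
  (forall x : A, normc (f x) <= K * cnorm x) -> state_space f.
Proof.
move=> /positive_functional_le_norm le1; split => //.
  apply: (@bounded_linear_continuous _ (normed_of A) R[i]^o f).
  apply/linear_boundedP; exists 1; split; first exact: real1.
  move=> r r1 x; apply: (@le_trans _ _ (cnorm (x : A))%:C).
    by rewrite -normcE_norm lecR.
  have x0 : 0 <= (cnorm (x : A))%:C by rewrite ler0c cnorm_ge0.
  exact: (ler_peMl x0 (ltW r1)).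
rewrite /dual_norm; set E := [set _ | _ in _]; have ubE : ubound E 1.
  by move=> _ [x x1 <-]; exact: le_trans (le1 x) x1.
have E1 : E 1 by exists 1; [exact: cnorm1_le1 | rewrite f1 normc1].
apply/eqP; rewrite eq_le; apply/andP; split; first by apply: ge_sup => //; exists 1.
by apply: ub_le_sup => //; exists 1.
Qed.

End PositiveFunctional.

(** * Norm bounds for states, and compressions *)

Lemma state_le_norm {R : realType} {A : cstarAlgType R} {f : {scalar A}} :
  state_space f -> forall x : A, normc (f x) <= cnorm x.
Proof.
move=> [_ _ f1 _] x; have [->|xn0] := eqVneq x 0.
  by rewrite raddf0 normc0 cnorm_ge0.
have x_gt0 : 0 < cnorm x.
  by rewrite lt0r cnorm_ge0 andbT; apply: contraNneq xn0 => /cnorm0_eq0 ->.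
have normV : normc ((cnorm x)^-1%:C) = (cnorm x)^-1.
  by apply: complexI; rewrite normcE_norm ger0_norm // ler0c invr_ge0 ltW.
have : normc (f ((cnorm x)^-1%:C *: x)) <= dual_norm f.
  apply: ub_le_sup.
    (* [sup] of a set without supremum is [0], so [dual_norm f = 1] gives
       boundedness. *)
    apply: contrapT => nub; have := oner_neq0 R; rewrite -f1 /dual_norm sup_out ?eqxx //.
    by move=> [].
  exists ((cnorm x)^-1%:C *: x) => //=.
  by rewrite cnormZ normV mulVf // lt0r_neq0.
rewrite f1 linearZ /= normcM normV mulrC ler_pdivrMr ?mul1r //.
Qed.

(** For a state [f], this is the normalised vector state of the class of [w] in the GNS
    representation of [f]. *)
Definition compression {R : realType} {A : cstarAlgType R} (f : {scalar A})
  (w x : A) : R[i] := f (star w * x * w) / f (star w * w).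

Lemma compression_is_scalar {R : realType} {A : cstarAlgType R} (f : {scalar A})
  (w : A) : scalar (compression f w).
Proof.
move=> c x y; rewrite /compression mulrDr mulrDl -scalerAr -scalerAl.
by rewrite linearD linearZ /= mulrDl mulrA.
Qed.

HB.instance Definition _ (R : realType) (A : cstarAlgType R) (f : {scalar A})
    (w : A) :=
  GRing.isLinear.Build R[i] A R[i] *%R (compression f w)
    (compression_is_scalar f w).

(** Positivity holds because [star w * (star x * x) * w] is [star (x * w) * (x * w)];
    submultiplicativity of the norm supplies the bound. *)
Lemma compression_state {R : realType} {A : cstarAlgType R} (f : {scalar A})
    (w : A) : state_space f -> f (star w * w) != 0 ->
  state_space (compression f w : {scalar A}).
Proof.
move=> f_state wn0; have [_ f_pos _ f1] := f_state.
apply: (@positive_functional_state _ _ _ _ _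
  (cnorm (star w) * cnorm w * normc (f (star w * w))^-1)).
- move=> x; rewrite /compression mulr_ge0 ?invr_ge0 //.
  by rewrite mulrA -mulrA -starM.
- by rewrite /= /compression mulr1 divff.
move=> x; rewrite /= /compression normcM mulrAC; apply: ler_wpM2r.
  exact: normc_ge0.
apply: le_trans (state_le_norm f_state _) _.
apply: le_trans (cnormM _ _) _; rewrite mulrAC; apply: ler_wpM2r.
  exact: cnorm_ge0.
exact: cnormM.
Qed.

(** * Domination by a state with the same value *)

Lemma exists_dominating_state0 {R : realType} {A : cstarAlgType R}
    (f : {scalar A}) (b : A) : state_space f -> f b = 0 ->
  exists g : {scalar A}, [/\ state_space g, g b = 0 &
    f (star b * b) <= g (b * star b)].
Proof.
move=> f_state fb0; have [_ f_pos _ f1] := f_state.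
have fsb0 : f (star b) = 0 by rewrite positive_functional_star // fb0 conjc0.
have fbb_ge0 : 0 <= f (b * star b) by rewrite -{1}(starK b).
have [r0|rn0] := eqVneq (f (star b * b)) 0; first by exists f; rewrite r0.
have r_gt0 : 0 < f (star b * b) by rewrite lt0r rn0 f_pos.
set r := f (star b * b) in rn0 r_gt0 *.
have rJ : r^*%C = r by rewrite /r positive_functional_Re // conjc_real.
pose B := f (b * b); pose C := f (star b * b * b).
have BJ : f (star b * star b) = B^*%C by rewrite -starM positive_functional_star.
(* If r <= |B|, Cauchy-Schwarz gives r^2 <= |B|^2 <= f(b b^* ) r. *)
have [le_rB|lt_Br] := real_leP (gtr0_real r_gt0) (normr_real B).
  exists f; split=> //; rewrite -(ler_pM2r r_gt0) -expr2.
  have := positive_functional_CS _ f_pos (star b) b r_gt0.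
  rewrite BJ normcJ starK; apply: le_trans.
  by rewrite lerXn2r ?nnegrE ?normr_ge0 ?(ltW r_gt0).
(* This is the determinant of the linear system formed by the equation for [t] and its conjugate;
   Cramer's rule then yields the witness. *)
have Dn0 : r * r - B^*%C * B != 0.
  by rewrite [_^*%C * _]mulrC -sqr_normc -expr2 lt0r_neq0 //
     subr_gt0 ltrXn2r ?nnegrE // ltW.
have [t t_eq] : exists t, t * r + t^*%C * B + C = 0.
  exists ((B * C^*%C - r * C) / (r * r - B^*%C * B)).
  rewrite conjcM conjc_inv !(conjcD, conjcN, conjcM) !conjcK rJ.
  by field; rewrite [X in _ - X]mulrC.
have t_eqJ : t^*%C * r + t * B^*%C + C^*%C = 0.
  by rewrite -[RHS](conjc0 R) -t_eq !conjcD !conjcM conjcK rJ.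
pose w := t%:A + b.
have wE : star w = t^*%C%:A + star b by rewrite starD starZ star1.
have NE : f (star w * w) = t^*%C * t + r.
  rewrite wE /w !(mulrDl, mulrDr) -!(@scalerAl _ A, @scalerAr _ A) !(mul1r, mulr1).
  by rewrite !linearD !linearZ /= f1 fb0 fsb0 -/r; ring.
have N_gt0 : 0 < f (star w * w).
  by rewrite NE mulrC -sqr_normc ltr_wpDl // exprn_ge0.
exists (compression f w : {scalar A}); split.
- exact: compression_state (lt0r_neq0 N_gt0).
- rewrite /= /compression -[RHS](mul0r (f (star w * w))^-1); congr (_ / _).
  rewrite wE /w !(mulrDl, mulrDr) -!(@scalerAl _ A, @scalerAr _ A) !(mul1r, mulr1).
  rewrite !linearD !linearZ /= fb0 -/r -/B -/C -[RHS]t_eq; ring.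
rewrite /= /compression ler_pdivlMr // NE.
(* In the GNS space, [star b * w] has inner products r with [1] and -conj(t) r with [b], the latter
   by the equation for [t]. As [1] and [b] are orthogonal with squared norms 1 and r, Bessel's lower
   bound is r^2 + |t|^2 r, which is r f(w^* w). *)
have fwb : f (star w * b) = r.
  rewrite wE mulrDl -scalerAl mul1r linearD linearZ /= fb0 -/r; ring.
have fbw : f (star b * w) = r.
  by rewrite positive_functional_herm // fwb.
have fwbb : f (star w * b * b) = - (t * r).
  rewrite wE !mulrDl -!(@scalerAl _ A) mul1r linearD linearZ /= -/B -/C.
  by apply/eqP; rewrite -subr_eq0 opprK -[X in _ == X]t_eq; apply/eqP; ring.
have fbbw : f (star b * (star b * w)) = - (t^*%C * r).
  rewrite mulrA -starM positive_functional_herm // mulrA fwbb.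
  by rewrite conjcN conjcM rJ.
clearbody w.
(* The summands after [star b * w] remove its components along [1] and [b] in
   the inner product [f (star y * x)], so positivity is Bessel's inequality. *)
have := f_pos (star b * w + (- r)%:A + t^*%C *: b).
rewrite !starD !starZ starM starK star1 conjcK conjcN rJ.
rewrite !(mulrDl, mulrDr) -!(@scalerAl _ A, @scalerAr _ A) !(mul1r, mulr1) !mulrA.
rewrite !mulrA in fbbw *.
rewrite !linearD !linearZ /= f1 fb0 fsb0 fwb fbw fwbb fbbw -/r.
rewrite -[in X in _ -> X]subr_ge0; congr (0 <= _); ring.
Qed.

(** Translating by the scalar [f a] lowers both sides by the same |f(a)|^2, since [g a = f a]. *)
Lemma exists_dominating_state {R : realType} {A : cstarAlgType R}
    (f : {scalar A}) (a : A) : state_space f ->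
  exists g : {scalar A}, [/\ state_space g, g a = f a &
    complex.Re (f (star a * a)) <= complex.Re (g (a * star a))].
Proof.
move=> f_state; pose b := a + (- f a)%:A.
have [_ f_pos _ f1] := f_state.
have [|g [g_state gb le_fg]] := exists_dominating_state0 f b f_state.
  by rewrite linearD linearZ /= f1 mulr1 subrr.
have [_ g_pos _ g1] := g_state.
have ga : g a = f a.
  by apply/eqP; rewrite -subr_eq0 -gb linearD linearZ /= g1 mulr1.
exists g; split=> //.
suff : f (star a * a) <= g (a * star a) by rewrite lecE => /andP[].
move: le_fg; rewrite starD starZ star1 conjcN.
rewrite !(mulrDl, mulrDr) -!(@scalerAl _ A, @scalerAr _ A) !(mul1r, mulr1).
rewrite !linearD !linearZ /= f1 g1 !positive_functional_star // ga.
by rewrite -subr_ge0 -[in X in _ -> X]subr_ge0; congr (0 <= _); ring.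
Qed.

(** * Numerical ranges and heights under the involution *)

Lemma num_range_star {R : realType} {A : cstarAlgType R} (a : A) (mu : R[i]) :
  num_range a mu -> num_range (star a) mu^*%C.
Proof.
move=> [f f_state <-]; exists f => //.
by have [_ f_pos _ f1] := f_state; rewrite positive_functional_star.
Qed.

(** Ensures that the [sup] in [height] bounds every element of the fiber. *)
Lemma fiber_has_ubound {R : realType} {A : cstarAlgType R} (a : A) (mu : R[i]) :
  has_ubound (fiber a mu).
Proof.
exists (cnorm (star a * a)) => _ [f f_state [_ <-]].
apply: le_trans (state_le_norm f_state _).
have [_ f_pos _ _] := f_state.
by rewrite -lecR normcE_norm RRe_real ?ger0_real // ger0_norm.
Qed.

(** The dominating state of each [f] over [mu] contributes to the fiber of [star a] over the
    conjugate of [mu]. *)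
Lemma height_le_star {R : realType} {A : cstarAlgType R} (a : A) (mu : R[i]) :
  num_range a mu -> height a mu <= height (star a) mu^*%C.
Proof.
move=> [f0 f0_state f0a]; apply: ge_sup.
  by exists (complex.Re (f0 (star a * a))), f0; rewrite ?f0a.
move=> _ [f f_state [<- <-]].
have [g [g_state ga le_fg]] := exists_dominating_state f a f_state.
apply: le_trans le_fg _; apply: ub_le_sup; first exact: fiber_has_ubound.
exists g => //; have [_ g_pos _ g1] := g_state.
by rewrite starK positive_functional_star // ga.
Qed.

(** The reverse inequality is [height_le_star] at [star a], as both involutions square to the
    identity. *)
Lemma height_star {R : realType} {A : cstarAlgType R} (a : A) (mu : R[i]) :
  num_range a mu -> height (star a) mu^*%C = height a mu.
Proof.
move=> a_mu; apply/eqP; rewrite eq_le height_le_star // andbT.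
rewrite -[in X in _ <= X](starK a) -[in X in _ <= X](conjcK mu).
exact/height_le_star/num_range_star.
Qed.

Theorem theorem2p17 (R : realType) (A : cstarAlgType R) (a : A) :
  upper_boundary (star a) =
  [set (conjc mu, height a mu) | mu in
    [set mu : (complex R) | upper_boundary a (mu, height a mu)]].
Proof.
apply/seteqP; split=> [_ [mu a_mu <-]|_ [mu [nu a_nu [<- _]] <-]].
  have a_muJ : num_range a mu^*%C by rewrite -(starK a); exact: num_range_star.
  exists mu^*%C; first by exists mu^*%C.
  by rewrite -height_star // conjcK.
exists nu^*%C; first exact: num_range_star.
by rewrite height_star.
Qed.
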